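(* There exists a universal constant $c>0$ such that for all $T\in\mathbb{N}$, all $\rho\ge1$, all $\delta\in(0,\tfrac12]$, and every stochastic first-order algorithm $\mathsf{alg}\in\mathcal{A}_{\mathsf{SFO}}$, $$\mathsf{PoA}_T^{\delta}\big(\mathsf{alg},\mathcal{M}_{\mathsf{Lip}}^{1,\rho}\big)\;\ge\;\mathsf{PoA}_T^{\delta}\big(\mathsf{alg},\mathcal{M}_{\mathsf{Lip}}^{1,\rho};\mathcal{A}_{\mathsf{SFO}}\big)\;\ge\; c\,\sqrt{\frac{\min\big\{\log\big(\tfrac1\delta\log\rho\big),\,T\big\}}{\log\tfrac1\delta}},$$ where the last expression is read as $0$ when $\log\rho\le\delta$ (i.e., when $\log(\tfrac1\delta\log\rho)$ is nonpositive or undefined).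
   Context: Here $\mathbb{N}=\{1,2,\dots\}$, $\log$ is the natural logarithm, and the domain is $\mathcal{X}=\mathbb{R}$. Stochastic optimization (SO) instances. An SO instance is a pair $(f,P)$, where $P$ is a probability distribution on a sample space $\mathcal{S}$ and $f:\mathcal{X}\times\mathcal{S}\to\mathbb{R}$ is such that $F_{f,P}(x):=\mathbb{E}_{S\sim P}f(x;S)$ is well defined and finite for all $x\in\mathcal{X}$. Let $X^\star_{f,P}:=\arg\min_{x\in\mathcal{X}}F_{f,P}(x)$. The norm of a set means the infimum of the norms of its elements ($\infty$ for the empty set). Each convex sample function $f(\cdot;s)$ comes with an arbitrary (measurable) subgradient selection $\nabla f(x;s)\in\partial f(x;s)$, which is regarded as part of the instance. For $L,R>0$, $\mathcal{I}_{\mathsf{Lip}}^{L,R}$ is the class of instances such that $f(\cdot;s)$ is convex and $L$-Lipschitz on $\mathcal{X}$ for all $s\in\mathcal{S}$, and $\|X^\star_{f,P}\|\le R$. Algorithms. Let $S_1,\dots,S_T$ be i.i.d. from $P$ and let $\xi\sim\mathsf{Unif}([0,1])$ be independent of them. $\mathcal{A}_{\mathsf{SO}}$ is the set of all SO algorithms, whose output is $x_T=\mathsf{alg}_T(f(\cdot;S_1),\dots,f(\cdot;S_T);\xi)\in\mathcal{X}$ for some measurable mapping $\mathsf{alg}_T$ (the sample functions are given together with their subgradient selections). $\mathcal{A}_{\mathsf{SFO}}\subset\mathcal{A}_{\mathsf{SO}}$ is the set of stochastic first-order algorithms, which start at $x_0=0$ and whose iterates are $x_t=\mathsf{alg}_t(\nabla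 f(x_0;S_1),\dots,\nabla f(x_{t-1};S_t);\xi)\in\mathcal{X}$ for $t=1,\dots,T$, with measurable mappings $\mathsf{alg}_t$; the output is $x_T$. Error at confidence level $\delta$. $\mathsf{Err}_T^{\delta}(\mathsf{alg},(f,P)):=Q_{1-\delta}(F_{f,P}(x_T))-\inf_{x\in\mathcal{X}}F_{f,P}(x)$, where $Q_p(Y):=\min\{y:\mathbb{P}(Y\le y)\ge p\}$. For a class $\mathcal{I}$ of instances, $\mathsf{Err}_T^{\delta}(\mathsf{alg},\mathcal{I}):=\sup_{(f,P)\in\mathcal{I}}\mathsf{Err}_T^{\delta}(\mathsf{alg},(f,P))$, and for a class $\mathcal{A}$ of algorithms $\mathsf{Err}_T^{\delta}(\mathcal{A},\mathcal{I}):=\inf_{\mathsf{alg}\in\mathcal{A}}\mathsf{Err}_T^{\delta}(\mathsf{alg},\mathcal{I})$. Price of adaptivity. For $\ell,\rho\ge1$, $\mathcal{M}_{\mathsf{Lip}}^{\ell,\rho}:=\{\mathcal{I}_{\mathsf{Lip}}^{L,R}: L\in[1,\ell],\,R\in[1,\rho]\}$. For a collection $\mathcal{M}$ of instance classes, $\mathsf{PoA}_T^{\delta}(\mathsf{alg},\mathcal{M};\mathcal{A}):=\sup_{\mathcal{I}\in\mathcal{M}}\dfrac{\mathsf{Err}_T^{\delta}(\mathsf{alg},\mathcal{I})}{\mathsf{Err}_T^{\delta}(\mathcal{A},\mathcal{I})}$ and $\mathsf{PoA}_T^{\delta}(\mathsf{alg},\mathcal{M}):=\mathsf{PoA}_T^{\delta}(\mathsf{alg},\mathcal{M};\mathcal{A}_{\mathsf{SO}})$.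 *)

(* Defs.v *)
From HB Require Import structures.
From mathcomp Require Export all_boot all_order all_algebra.
From mathcomp Require Export all_classical all_reals all_analysis.
Export Order.TTheory GRing.Theory Num.Theory.
Export numFieldNormedType.Exports.

Set Implicit Arguments.
Unset Strict Implicit.
Unset Printing Implicit Defensive.

Global Open Scope classical_set_scope.
Global Open Scope ring_scope.

Section iid.
Context d (S : measurableType d) (R : realType) (P : probability S R).

Definition cons_pair n (p : S * n.-tuple S) : n.+1.-tuple S :=
  [the n.+1.-tuple S of p.1 :: p.2].

Lemma measurable_cons_pair n : measurable_fun setT (@cons_pair n).
Proof. exact: measurable_cons. Qed.

HB.instance Definition _ n :=
  isMeasurableFun.Build _ _ _ _ (@cons_pair n) (@measurable_cons_pair n).

(* The n-fold product measure, i.e. the joint law of n i.i.d. draws from P. *)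
Fixpoint iid n : probability (n.-tuple S) R :=
  match n with
  | 0 => \d_([tuple] : 0.-tuple S)
  | n'.+1 => distribution (P \x iid n')%E (@cons_pair n')
  end.

End iid.

(* For 0 < p < 1 and Y measurable the infimum is attained, hence a minimum. *)
Definition quantile d (W : measurableType d) (R : realType)
    (P : probability W R) (p : R) (Y : W -> R) : \bar R :=
  ereal_inf [set y%:E | y in [set y : R | (p%:E <= P [set w | (Y w <= y)%R])%E]].

Definition convex (R : realType) (h : R -> R) : Prop :=
  @convex_function R R^o [set: convex_lmodType R^o] h.

Definition subdifferential (R : realType) (h : R -> R) (x : R) : set R :=
  [set v | forall y, h x + v * (y - x) <= h y].

Definition argmin (R : realType) (h : R -> R) : set R :=
  [set x | forall y, h x <= h y].

Definition set_norm (R : realType) (A : set R) : \bar R :=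
  ereal_inf [set `|x|%:E | x in A].

(* What an algorithm is given about one sample: the sample function together
   with its subgradient selection. *)
Record sample_fun (R : realType) := SampleFun {
  sf_val : R -> R;
  sf_grad : R -> R
}.

(* For convex sample functions, joint measurability of inst_fun follows from
   inst_integrable: they are continuous in x and measurable in s.
   inst_grad is unconstrained at those s for which inst_fun^~ s is not convex. *)
Record instance (R : realType) := Instance {
  inst_disp : measure_display;
  inst_space : measurableType inst_disp;
  inst_law : probability inst_space R;
  inst_fun : R -> inst_space -> R;
  inst_grad : R -> inst_space -> R;
  inst_measurable_fun :
    measurable_fun setT (fun p : R * inst_space => inst_fun p.1 p.2);
  inst_measurable_grad :
    measurable_fun setT (fun p : R * inst_space => inst_grad p.1 p.2);
  inst_integrable : forall x,
    inst_law.-integrable setT (fun s => (inst_fun x s)%:E);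
  inst_subgradient : forall s, convex (inst_fun^~ s) ->
    forall x, subdifferential (inst_fun^~ s) x (inst_grad x s)
}.

Arguments inst_fun {R} i x s.
Arguments inst_grad {R} i x s.

Definition objective (R : realType) (i : instance R) (x : R) : R :=
  fine ('E_(inst_law i)[inst_fun i x])%E.

Definition sample_of (R : realType) (i : instance R) (s : inst_space i) :
    sample_fun R :=
  SampleFun ((inst_fun i)^~ s) ((inst_grad i)^~ s).

(* Universe levels prevent instance R from being the index type of a set; classes
   of instances are plain predicates instead. *)
Definition instance_class (R : realType) := instance R -> Prop.

Definition lip_class (R : realType) (L r : R) : instance_class R := fun i =>
  [/\ forall s, convex ((inst_fun i)^~ s),
      forall s, L.-lipschitz_[set: R^o] ((inst_fun i)^~ s : R^o -> R^o)
    & (set_norm (argmin (objective i)) <= r%:E)%E].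

(* The last argument is the value of the random seed xi. *)
Definition algorithm (R : realType) (T : nat) : Type :=
  T.-tuple (sample_fun R) -> R -> R.

Definition run (R : realType) T (alg : algorithm R T) (i : instance R)
    (w : T.-tuple (inst_space i) * R) : R :=
  alg (map_tuple (@sample_of R i) w.1) w.2.

(* Measurability refers to the largest sigma-algebra on tuples of sample
   functions (times seeds) that makes the sampling maps
   (s_1, .., s_T, xi) |-> (f(.; s_1), .., f(.; s_T), xi) of all instances
   measurable.  For the sigma-algebra generated by the point evaluations,
   (g, x) |-> g x is not jointly measurable, so that adaptive first-order
   methods would not qualify. *)
Definition so_algs (R : realType) T : set (algorithm R T) :=
  [set alg | forall i : instance R, measurable_fun setT (run alg (i := i))].

Definition sfo_algs (R : realType) T : set (algorithm R T) :=
  [set alg | exists2 step : forall t : nat, t.-tuple R * R -> R,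
    (forall t, measurable_fun setT (step t)) &
    forall (z : T.-tuple (sample_fun R)) (xi : R), exists x : nat -> R,
      [/\ x 0%N = 0,
          forall t : 'I_T, x t.+1 = step t.+1
            ([tuple sf_grad (tnth z (widen_ord (ltn_ord t) j)) (x j)
             | j < t.+1], xi)
        & alg z xi = x T]].

Definition err (R : realType) T (delta : R) (alg : algorithm R T)
    (i : instance R) : \bar R :=
  (quantile (iid (inst_law i) T \x uniform_prob (@ltr01 R)) (1 - delta)
     (fun w => objective i (run alg w))
   - ereal_inf (range (fun x => (objective i x)%:E)))%E.

Definition class_err (R : realType) T (delta : R) (alg : algorithm R T)
    (I : instance_class R) : \bar R :=
  ereal_sup [set e | exists2 i, I i & e = err delta alg i].

Definition minimax_err (R : realType) T (delta : R) (A : set (algorithm R T))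
    (I : instance_class R) : \bar R :=
  ereal_inf [set class_err delta alg I | alg in A].

Definition lip_classes (R : realType) (l rho : R) : instance_class R -> Prop :=
  fun I =>
    exists L r : R, [/\ 1 <= L <= l, 1 <= r <= rho & I = lip_class L r].

Definition poa (R : realType) T (delta : R) (alg : algorithm R T)
    (M : instance_class R -> Prop) (A : set (algorithm R T)) : \bar R :=
  ereal_sup [set q | exists2 I, M I &
    q = (class_err delta alg I / minimax_err delta A I)%E].

Definition poa_lower_bound (R : realType) (T : nat) (rho delta : R) : R :=
  if ln rho <= delta then 0
  else Num.sqrt (Num.min (ln (delta^-1 * ln rho)) T%:R / ln delta^-1).

(* Main.v *)
Require Import Defs.
From mathcomp Require Import unstable measurable_realfun ring lra.

(* Lower side: let a stochastic gradient be the slope of |x - m| at the query,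
   with its sign flipped with probability (1 - eps) / 2, so that the objective is
   eps |x - m|.  A first-order method only sees T noisy signs, and locating m
   among K well separated candidates is impossible once (1 + eps^2)^T <= K / 8:
   the likelihood ratio against fair signs has second moment (1 + eps^2)^T, while
   under fair signs the events that the output is near the k-th candidate are
   disjoint.  The candidates exp (2 k) <= rho give K of order log rho, hence for
   some r <= rho an error of order r sqrt (min (log log rho, T) / T), already at
   confidence level 1/2.
   Upper side: projected SGD that knows r has error O (r sqrt (D / T)), where
   D = log (1 / delta).  When log log rho = O (D), the bound to prove is constant
   and follows from the price of adaptivity being at least 1, which only needs
   the error of every method to be positive. *)

Set Implicit Arguments.
Unset Strict Implicit.
Unset Printing Implicit Defensive.

Local Open Scope convex_scope.

(** * Measurability of first-order methods; sign and monotonicity of the errors *)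

Section general.
Context {R : realType}.
Implicit Types (i : instance R) (delta : R).

(** Strong induction on time: an iterate is a measurable [step] of gradients, and each gradient
    composes the jointly measurable [inst_grad] with an earlier iterate. *)
Lemma measurable_iterate i T (step : forall t : nat, t.-tuple R * R -> R)
    (x : nat -> T.-tuple (inst_space i) * R -> R) :
  (forall t, measurable_fun setT (step t)) ->
  (forall w, x 0%N w = 0) ->
  (forall w (t : 'I_T), x t.+1 w = step t.+1
     ([tuple inst_grad i (x j w) (tnth w.1 (widen_ord (ltn_ord t) j))
      | j < t.+1], w.2)) ->
  forall t, (t <= T)%N -> measurable_fun setT (x t).
Proof.
move=> mstep x0 xS; elim/ltn_ind => -[|t] IH tT.
  rewrite (_ : x 0%N = cst 0); last by apply/funext => w; rewrite x0.
  exact: measurable_cst.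
pose u (w : T.-tuple (inst_space i) * R) :=
  [tuple inst_grad i (x j w) (tnth w.1 (widen_ord tT j)) | j < t.+1].
rewrite (_ : x t.+1 = step t.+1 \o (fun w => (u w, w.2))); last first.
  apply/funext => w; rewrite (xS w (Ordinal tT)) /=.
  congr (step _ (_, _)); apply/eq_from_tnth => j; rewrite !tnth_mktuple.
  by congr (inst_grad i _ (tnth _ _)); apply/val_inj.
apply: measurableT_comp; [exact: mstep|apply: measurable_fun_pair => //=].
apply/measurable_fun_tnthP => j.
rewrite (_ : _ \o _ = (fun p => inst_grad i p.1 p.2) \o
   (fun w => (x j w, tnth w.1 (widen_ord tT j)))); last first.
  by apply/funext => w /=; rewrite tnth_mktuple.
apply: measurableT_comp; first exact: inst_measurable_grad.
apply: measurable_fun_pair.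
  by apply: IH; rewrite // ltnW // (leq_trans (ltn_ord j)).
exact: (measurableT_comp (measurable_tnth _)).
Qed.

(** [sfo_algs] provides a trajectory for each input separately. Choice makes them functions of the
    input; it is their recursion that makes these measurable. *)
Lemma sfo_sub_so T : sfo_algs (R := R) (T := T) `<=` so_algs (T := T).
Proof.
move=> alg [step mstep hx] i.
have /choice [x xP] : forall w : T.-tuple (inst_space i) * R,
  exists x : nat -> R,
  [/\ x 0%N = 0,
      forall t : 'I_T, x t.+1 = step t.+1
        ([tuple inst_grad i (x j) (tnth w.1 (widen_ord (ltn_ord t) j))
         | j < t.+1], w.2)
    & run alg w = x T].
  move=> w; have [x [x0 xS xT]] := hx (map_tuple (@sample_of R i) w.1) w.2.
  exists x; split => // t; rewrite xS; congr (step _ (_, _)).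
  by apply/eq_from_tnth => j; rewrite !tnth_mktuple tnth_map.
rewrite (_ : run alg (i := i) = fun w => x w T); last first.
  by apply/funext => w; case: (xP w).
apply: (@measurable_iterate i T step (fun t w => x w t)) => //.
- by move=> w; case: (xP w).
- by move=> w t; case: (xP w).
Qed.

Lemma objectiveE i x :
  objective i x = (\int[inst_law i]_s inst_fun i x s)%R.
Proof. by rewrite /objective unlock. Qed.

(** A finite norm excludes an empty set of minimizers; the slack [e] is there because that norm is
    an infimum. *)
Lemma lip_class_argmin i (L r e : R) : lip_class L r i -> 0 < e ->
  exists2 x, argmin (objective i) x & `|x| < r + e.
Proof.
move=> [_ _ hr] e0.
have /ereal_inf_lt [_ [x xm <-]] : (set_norm (argmin (objective i)) < (r + e)%:E)%E.
  by apply: le_lt_trans hr _; rewrite lte_fin ltrDl.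
by rewrite lte_fin => xr; exists x.
Qed.

Lemma inf_argmin i x : argmin (objective i) x ->
  ereal_inf (range (fun x => (objective i x)%:E)) = (objective i x)%:E.
Proof.
move=> xm; apply/eqP; rewrite eq_le; apply/andP; split.
  by apply: ereal_inf_lbound; exists x.
by apply: le_ereal_inf_tmp => _ [y _ <-]; rewrite lee_fin.
Qed.

(** A threshold below the minimum has an empty event, whose probability 0 is less than
    [1 - delta]. *)
Lemma err_ge0 T delta (alg : algorithm R T) i (L r : R) :
  delta < 1 -> lip_class L r i -> (0 <= err delta alg i)%E.
Proof.
move=> d1 /lip_class_argmin /(_ ltr01) [x xm _].
rewrite /err (inf_argmin xm) sube_ge0 ?ltNyr //.
apply: le_ereal_inf_tmp => _ [y /= hy <-]; rewrite lee_fin.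
have [[w hw]|] := pselect (exists w, objective i (run alg (i := i) w) <= y).
  exact: le_trans (xm _) hw.
move=> /forallNP no; move: hy; rewrite (_ : [set _ | _] = set0); last first.
  by apply/seteqP; split => // w /no.
by rewrite measure0 lee_fin leNgt subr_gt0 d1.
Qed.

Lemma class_err_ge0 T delta (alg : algorithm R T) (L r : R) i :
  delta < 1 -> lip_class L r i -> (0 <= class_err delta alg (lip_class L r))%E.
Proof.
move=> d1 ii; apply: le_trans (err_ge0 alg d1 ii) _.
by apply: ereal_sup_ubound; exists i.
Qed.

Lemma minimax_err_ge0 T delta (A : set (algorithm R T)) (L r : R) i :
  delta < 1 -> lip_class L r i -> (0 <= minimax_err delta A (lip_class L r))%E.
Proof.
by move=> d1 ii; apply: le_ereal_inf_tmp => _ [alg _ <-]; exact: class_err_ge0 ii.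
Qed.

Lemma minimax_err_le T delta (A B : set (algorithm R T)) (I : instance_class R) :
  A `<=` B -> (minimax_err delta B I <= minimax_err delta A I)%E.
Proof. by move=> AB; apply: ereal_inf_le_tmp => _ [alg /AB ? <-]; exists alg. Qed.

(** More competitors lower the denominator. Inversion reverses the order on nonnegative values, and
    nonnegativity comes from an instance in each class. *)
Lemma poa_le T delta (alg : algorithm R T) (M : instance_class R -> Prop)
    (A B : set (algorithm R T)) :
  delta < 1 ->
  (forall I, M I -> exists (L r : R) i, I = lip_class L r /\ lip_class L r i) ->
  A `<=` B -> (poa delta alg M A <= poa delta alg M B)%E.
Proof.
move=> d1 MI AB; apply: ge_ereal_sup => _ [I /[dup] MIi /MI[L [r [i [IE ii]]]] ->].
apply: (@le_trans _ _ (class_err delta alg I / minimax_err delta B I)%E).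
  rewrite IE lee_wpmul2l ?(class_err_ge0 _ _ ii)//.
  rewrite lee_pV2 ?inE ?(minimax_err_ge0 _ _ ii)//.
  exact: minimax_err_le.
by apply: ereal_sup_ubound; exists I.
Qed.

End general.

(** * Hard instances *)

Section hard.
Context {R : realType}.
Implicit Types (m eps x : R) (s : bool * bool).

Lemma measurable_fun_bool2 d (T : measurableType d) (g : bool * bool -> T) :
  measurable_fun setT g.
Proof.
have -> : g = fun p => if p.2 then g (p.1, true) else g (p.1, false).
  by apply/funext => -[? []].
have mg c : measurable_fun setT (fun b : bool => g (b, c)) by [].
have mgfst c : measurable_fun setT (fun b : bool * bool => g (b.1, c)).
  exact: measurableT_comp (mg c) measurable_fst.
exact: measurable_fun_ifT.
Qed.

(* A draw reveals the slope of |x - m| with probability eps, and is a fair sign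
   otherwise. *)
Definition hard_fun m x s : R :=
  if s.2 then `|x - m| else if s.1 then x - m else m - x.

(** A subgradient of |x - m| that is never 0, so that every gradient of a hard instance is a
    sign. *)
Definition side m x : R := if x < m then -1 else 1.

Definition hard_grad m x s : R :=
  if s.2 then side m x else if s.1 then 1 else -1.

Definition hard_law eps : probability (bool * bool)%type R :=
  (bernoulli_prob (2^-1 : R) \x bernoulli_prob eps)%E.

Lemma hard_integral eps (g : bool * bool -> \bar R) : 0 <= eps <= 1 ->
  (forall s, (0 <= g s)%E) ->
  (\int[hard_law eps]_s g s =
   (2^-1)%:E * (eps%:E * g (true, true) + (1 - eps)%:E * g (true, false)) +
   (2^-1)%:E * (eps%:E * g (false, true) + (1 - eps)%:E * g (false, false)))%E.
Proof.
move=> e01 g0; rewrite /hard_law fubini_tonelli1 //=; last first.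
  exact: measurable_fun_bool2.
have half01 : 0 <= (2^-1 : R) <= 1 by lra.
rewrite (integral_bernoulli_prob half01); last first.
  by move=> b; rewrite /fubini_F; apply: integral_ge0 => b' _.
rewrite /fubini_F !integral_bernoulli_prob // /onem.
by rewrite (_ : 1 - 2^-1 = 2^-1 :> R) //; lra.
Qed.

Lemma hard_lipschitz m x y s : `|hard_fun m x s - hard_fun m y s| <= `|x - y|.
Proof.
case: s => b []; rewrite /hard_fun /=.
  apply: le_trans (ler_dist_dist _ _) _.
  by rewrite (_ : x - m - (y - m) = x - y) //; ring.
case: b; first by rewrite (_ : x - m - (y - m) = x - y) //; ring.
by rewrite distrC (_ : m - y - (m - x) = x - y) //; ring.
Qed.

Lemma measurable_hard_fun m :
  measurable_fun setT (fun p : R * (bool * bool) => hard_fun m p.1 p.2).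
Proof.
apply: measurable_fun_ifT.
- exact: measurableT_comp.
- by apply: measurableT_comp => //; exact: measurable_funB.
- apply: measurable_fun_ifT => //; first exact: measurableT_comp.
    exact: measurable_funB.
  exact: measurable_funB.
Qed.

Lemma measurable_hard_grad m :
  measurable_fun setT (fun p : R * (bool * bool) => hard_grad m p.1 p.2).
Proof.
apply: measurable_fun_ifT.
- exact: measurableT_comp.
- by apply: measurable_fun_ifT => //; exact: measurable_fun_ltr.
- by apply: measurable_fun_ifT => //; exact: measurableT_comp.
Qed.

Lemma hard_integrable m eps x :
  (hard_law eps).-integrable setT (fun s => (hard_fun m x s)%:E).
Proof.
apply: (@le_integrable _ _ _ _ _ measurableT _ (EFin \o cst `|x - m|)) => //=.
- exact: measurable_fun_bool2.
- move=> [b1 b2] _; rewrite lee_fin /hard_fun /= normr_id.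
  by case: b2; rewrite ?normr_id //; case: b1; rewrite // distrC.
- exact: (@finite_measure_integrable_cst _ _ R (hard_law eps)).
Qed.

Lemma hard_subgradient m s x :
  subdifferential (fun x => hard_fun m x s) x (hard_grad m x s).
Proof.
move=> y; rewrite /hard_fun /hard_grad /side; case: s => -[] [] /=; try lra.
- case: ltP => xm.
    rewrite ltr0_norm ?subr_lt0 //; have := ler_norm (- (y - m)).
    by rewrite normrN; lra.
  by rewrite ger0_norm ?subr_ge0 //; have := ler_norm (y - m); lra.
- case: ltP => xm.
    rewrite ltr0_norm ?subr_lt0 //; have := ler_norm (- (y - m)).
    by rewrite normrN; lra.
  by rewrite ger0_norm ?subr_ge0 //; have := ler_norm (y - m); lra.
Qed.

Definition hard m eps : instance R :=
  @Instance R _ _ (hard_law eps) (hard_fun m) (hard_grad m)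
    (@measurable_hard_fun m) (@measurable_hard_grad m)
    (@hard_integrable m eps) (fun s _ => @hard_subgradient m s).

Lemma hard_convex m s : convex (fun x => hard_fun m x s).
Proof.
move=> t x y _ _; rewrite convRE /hard_fun /=.
have -> : x <| t |> y = t%:num * x + (1 - t%:num) * y :> R by [].
have t0 : 0 <= t%:num by [].
have t1 : 0 <= 1 - t%:num by rewrite subr_ge0.
rewrite /onem; move: (t%:num) t0 t1 => u u0 u1; case: s => -[] [] /=.
- rewrite (_ : u * x + (1 - u) * y - m = u * (x - m) + (1 - u) * (y - m));
    last by ring.
  apply: le_trans (ler_normD _ _) _.
  by rewrite !normrM (ger0_norm u0) (ger0_norm u1).
- by rewrite le_eqVlt; apply/orP; left; apply/eqP; ring.
- rewrite (_ : u * x + (1 - u) * y - m = u * (x - m) + (1 - u) * (y - m));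
    last by ring.
  apply: le_trans (ler_normD _ _) _.
  by rewrite !normrM (ger0_norm u0) (ger0_norm u1).
- by rewrite le_eqVlt; apply/orP; left; apply/eqP; ring.
Qed.

Lemma objective_hard m eps x : 0 <= eps <= 1 ->
  objective (hard m eps) x = eps * `|x - m|.
Proof.
move=> e01; rewrite objectiveE.
have ic (c : R) : (hard_law eps).-integrable setT (EFin \o cst c).
  exact: (@finite_measure_integrable_cst _ _ R (hard_law eps)).
(* [hard_integral] wants a nonnegative integrand, which adding |x - m| achieves; in the final sum
   the two fair signs cancel. *)
transitivity (\int[hard_law eps]_s (hard_fun m x s + cst `|x - m| s)
    - \int[hard_law eps]_s (cst `|x - m| s))%R.
  rewrite RintegralD //; last exact: hard_integrable.
  by rewrite addrK.
rewrite Rintegral_cst // /Rintegral hard_integral //; last first.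
  case=> b1 b2; rewrite lee_fin /hard_fun /=.
  have := ler_norm (x - m); have := ler_norm (- (x - m)); rewrite normrN.
  by case: b2 => //; case: b1; lra.
have -> : fine (hard_law eps setT) = 1 by rewrite probability_setT.
by rewrite /hard_fun /=; field.
Qed.

Lemma hard_argmin m eps : 0 <= eps <= 1 -> argmin (objective (hard m eps)) m.
Proof.
move=> e01 y; rewrite !objective_hard // subrr normr0 mulr0 mulr_ge0 //.
by case/andP: e01.
Qed.

Lemma hard_lip_class m eps r : 0 <= eps <= 1 -> `|m| <= r ->
  lip_class 1 r (hard m eps).
Proof.
move=> e01 mr; split => [s|s [x y] _|]; first exact: hard_convex.
  by rewrite /= mul1r; exact: hard_lipschitz.
apply: (@le_trans _ _ `|m|%:E); last by rewrite lee_fin.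
by apply: ereal_inf_lbound; exists m => //; exact: hard_argmin.
Qed.

(** If a threshold below [eps * d] had probability at least [1 - delta], which is at least 1/2, the
    output would be within [d] of [m] that often. *)
Lemma hard_err T delta (alg : algorithm R T) m eps d : 0 < eps <= 1 ->
  delta <= 2^-1 ->
  (((iid (hard_law eps) T) \x uniform_prob (@ltr01 R))
     [set w | (`|run alg (i := hard m eps) w - m| < d)%R] < (2^-1)%:E)%E ->
  measurable_fun setT (run alg (i := hard m eps)) ->
  ((eps * d)%:E <= err delta alg (hard m eps))%E.
Proof.
move=> /andP[e0 e1] d2 hP mrun; have e01 : 0 <= eps <= 1 by rewrite (ltW e0).
rewrite /err (inf_argmin (hard_argmin m e01)) objective_hard //.
rewrite subrr normr0 mulr0 sube0; apply: le_ereal_inf_tmp => _ [y /= hy <-].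
rewrite lee_fin leNgt; apply/negP => yd; move: hP; apply/negP; rewrite -leNgt.
apply: (@le_trans _ _ (1 - delta)%:E); first by rewrite lee_fin; lra.
apply: le_trans hy _; apply: le_measure; rewrite ?inE.
- rewrite -[X in measurable X]setTI.
  under eq_set => w do rewrite objective_hard //.
  apply: (@measurable_fun_ler _ _ _ setT _ (cst y)) => //.
  apply: measurable_funM => //; apply: measurableT_comp => //.
  exact: measurable_funB.
- rewrite -[X in measurable X]setTI.
  apply: (@measurable_fun_ltr _ _ _ setT _ (cst d)) => //.
  by apply: measurableT_comp => //; exact: measurable_funB.
- move=> w /=; rewrite objective_hard // => wy.
  by rewrite -(ltr_pM2l e0); exact: le_lt_trans wy yd.
Qed.

End hard.

(** * Locating the minimizer from noisy signs *)

Section fano.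
Context {R : realType}.
Implicit Types (q : seq R -> R) (h : seq R) (U : pred R) (m eps : R).

(* The probability that q lands in U once the gradients in h have been followed
   by n further ones; each of these is the slope of |x - m| at the point
   queried, with its sign flipped with probability (1 - eps) / 2. *)
Fixpoint hit_prob q m eps U n h : R :=
  if n is n'.+1 then
    (1 + eps) / 2 * hit_prob q m eps U n' (rcons h (side m (q h))) +
    (1 - eps) / 2 * hit_prob q m eps U n' (rcons h (- side m (q h)))
  else (U (q h))%:R.

(** The reference experiment: its signs do not depend on [m], so one law serves all candidates. *)
Fixpoint fair_hit_prob q U n h : R :=
  if n is n'.+1 then
    (fair_hit_prob q U n' (rcons h 1) + fair_hit_prob q U n' (rcons h (-1))) / 2
  else (U (q h))%:R.

(* AM-GM applied to the likelihood ratio, whose second moment under fair signs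
   is (1 + eps ^+ 2) ^+ n. *)
Lemma hit_prob_le q m eps U n h a : 0 <= eps <= 1 ->
  2 * a * hit_prob q m eps U n h <=
    a ^+ 2 * (1 + eps ^+ 2) ^+ n + fair_hit_prob q U n h.
Proof.
move=> e01; elim: n h a => [|n IH] h a /=.
  by rewrite expr0 mulr1; case: (U _) => /=; have := sqr_ge0 (a - 1);
    have := sqr_ge0 a; rewrite !expr2; lra.
set s := side m (q h).
(* The sign that agrees with the slope multiplies the likelihood ratio by 1 + eps, the other one by
   1 - eps; the weight [a] absorbs this factor. *)
have := IH (rcons h s) (a * (1 + eps)); have := IH (rcons h (- s)) (a * (1 - eps)).
have -> : fair_hit_prob q U n (rcons h 1) + fair_hit_prob q U n (rcons h (-1)) =
    fair_hit_prob q U n (rcons h s) + fair_hit_prob q U n (rcons h (- s)).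
  by rewrite /s /side; case: ifP => // _; rewrite opprK addrC.
set p1 := hit_prob _ _ _ _ _ _; set p2 := hit_prob _ _ _ _ _ _.
rewrite !exprMn (exprS (1 + eps ^+ 2) n); set M := (1 + eps ^+ 2) ^+ n => H1 H2.
have -> : a ^+ 2 * ((1 + eps ^+ 2) * M) =
    (a ^+ 2 * (1 - eps) ^+ 2 * M + a ^+ 2 * (1 + eps) ^+ 2 * M) / 2 by field.
by lra.
Qed.

Lemma fair_hit_prob_sum K q (U : 'I_K -> pred R) n h :
  (forall x, \sum_(k < K) (U k x)%:R <= 1 :> R) ->
  \sum_(k < K) fair_hit_prob q (U k) n h <= 1.
Proof.
move=> hU; elim: n h => [|n IH] h /=; first exact: hU.
rewrite -mulr_suml big_split /=; have := IH (rcons h 1).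
by have := IH (rcons h (-1)); lra.
Qed.

Lemma hit_prob_sum K q (m : 'I_K -> R) eps (U : 'I_K -> pred R) n h :
  0 <= eps <= 1 -> (forall x, \sum_(k < K) (U k x)%:R <= 1 :> R) ->
  8 * (1 + eps ^+ 2) ^+ n <= K%:R ->
  \sum_(k < K) hit_prob q (m k) eps (U k) n h <= 3 / 8 * K%:R.
Proof.
move=> e01 hU; set M := (1 + eps ^+ 2) ^+ n => MK.
have M0 : 0 < M by rewrite exprn_gt0 // ltr_wpDr ?sqr_ge0.
apply: (@le_trans _ _ (\sum_(k < K) (4^-1 + M * fair_hit_prob q (U k) n h))).
  (* The weight 1 / (2 M) bounds each term by 1/4 + M times its fair probability. The fair ones add
     up to at most 1 and M <= K / 8, whence K / 4 + K / 8 in all. *)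
  apply: ler_sum => k _; have := hit_prob_le q (m k) (U k) n h (2 * M)^-1 e01.
  rewrite -/M => /(ler_wpM2l (ltW M0)); congr (_ <= _); first by field; rewrite gt_eqF.
  by field; rewrite gt_eqF.
rewrite big_split /= -mulr_sumr sumr_const card_ord -mulr_natr.
have := fair_hit_prob_sum q n h hU; rewrite -(ler_pM2l M0) mulr1; lra.
Qed.

(** The history grows on the right while samples are consumed from the left, which matches the
    recursions of [hit_prob] and [iid]. *)
Fixpoint grads q m h (w : seq (bool * bool)) : seq R :=
  if w is s :: w' then grads q m (rcons h (hard_grad m (q h) s)) w' else h.

Lemma grads_rcons q m h w s : grads q m h (rcons w s) =
  rcons (grads q m h w) (hard_grad m (q (grads q m h w)) s).
Proof. by elim: w h => [|s' w IH] h //=. Qed.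

Lemma iid_consE d (S : measurableType d) (P : probability S R) n
    (A : set (n.+1.-tuple S)) :
  iid P n.+1 A = (\int[P]_s iid P n [set w | A (cons_pair (s, w))])%E.
Proof.
rewrite /= /distribution /pushforward /product_measure1.
apply: eq_integral => s _ /=; congr (iid P n _).
by apply/seteqP; split => w; rewrite /xsection /= inE.
Qed.

(** Integrating out the first draw reproduces the recursion of [hit_prob]: the true slope appears
    with probability eps + (1 - eps) / 2 = (1 + eps) / 2. *)
Lemma hit_probE q m eps U n h : 0 <= eps <= 1 ->
  iid (hard_law eps) n [set w | U (q (grads q m h w))] =
    (hit_prob q m eps U n h)%:E.
Proof.
move=> e01; elim: n h => [|n IH] h.
  rewrite /= diracE /= ; case: (boolP (U (q h))) => Uq.
    by rewrite mem_set.
  by rewrite memNset //=; apply/negP.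
rewrite iid_consE hard_integral //.
have E s : iid (hard_law eps) n [set w | U (q (grads q m h (cons_pair (s, w))))]
    = (hit_prob q m eps U n (rcons h (hard_grad m (q h) s)))%:E by rewrite -IH.
have {}E s : iid (hard_law eps) n
    [set w | [set w | U (q (grads q m h w))] (cons_pair (s, w))]
    = (hit_prob q m eps U n (rcons h (hard_grad m (q h) s)))%:E := E s.
rewrite !E /hard_grad /= -!EFinM -EFinD; congr EFin.
by rewrite /side; case: ifP => _; rewrite ?opprK; field.
Qed.

(** The product measure integrates sections over its first factor. By uniqueness one may condition
    on the second factor, here the seed, instead. *)
Lemma prod_ysectionE d1 d2 (T1 : measurableType d1) (T2 : measurableType d2)
    (m1 : probability T1 R) (m2 : probability T2 R) (A : set (T1 * T2)) :
  measurable A -> (m1 \x m2)%E A = (\int[m2]_y m1 [set x | A (x, y)])%E.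
Proof.
move=> mA; rewrite (product_measure_unique (m' := (m1 \x^ m2)%E)) //; last first.
  by move=> A1 A2 mA1 mA2; exact: product_measure2E.
by apply: eq_integral => y _; congr (m1 _); apply/seteqP; split => x;
    rewrite /ysection /= inE.
Qed.

(** For a fixed seed a first-order method is a deterministic map [q] from gradient histories to
    queries, the same for all [m] and [eps]; its output is the query after T gradients. *)
Lemma run_gradsE T (alg : algorithm R T) : sfo_algs alg ->
  exists q : R -> seq R -> R, forall m eps (w : T.-tuple (bool * bool)) xi,
    run alg (i := hard m eps) (w, xi) = q xi (grads (q xi) m [::] w).
Proof.
move=> [step _ hx].
(* The empty history is sent to the starting point 0. *)
pose q xi h := if size h is 0 then 0 else step (size h) (in_tuple h, xi).
have qE xi t (u : t.-tuple R) : (0 < t)%N -> q xi u = step t (u, xi).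
  case: u => u /= /[dup] /eqP ut; subst t => ut /= u0; rewrite /q.
  case: u ut u0 => // a u ut _ /=.
  by congr (step _ (_, _)); apply/val_inj.
exists q => m eps w xi; rewrite /run /=.
have [x [x0 xS ->]] := hx (map_tuple (@sample_of R (hard m eps)) w) xi.
pose g (j : nat) := hard_grad m (x j) (nth (true, true) w j).
have xg t : (t <= T)%N -> x t = q xi (mkseq g t).
  case: t => [|t] tT; first by rewrite x0.
  have := xS (Ordinal tT); rewrite -qE // => ->; congr (q xi).
  rewrite /mkseq -[iota 0 t.+1]val_enum_ord -map_comp.
  apply: eq_map => j /=.
  rewrite (_ : tnth _ _ = sample_of (i := hard m eps) (nth (true, true) w j)) //.
  by rewrite tnth_map; congr sample_of; rewrite (tnth_nth (true, true)).
suff gE t : (t <= T)%N -> grads (q xi) m [::] (take t w) = mkseq g t.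
  by rewrite xg // -gE // -{1}(size_tuple w) take_size.
elim: t => [|t IH] tT; first by rewrite take0.
rewrite (take_nth (true, true)) ?size_tuple // grads_rcons IH ?(ltnW tT) //.
by rewrite -xg ?(ltnW tT) // mkseqS.
Qed.

Lemma sum_disjoint_le1 K (U : 'I_K -> pred R) x :
  (forall k l, U k x -> U l x -> k = l) -> \sum_(k < K) (U k x)%:R <= 1 :> R.
Proof.
move=> hU; have [/existsP[k Uk]|/existsPn no] := boolP [exists k, U k x].
  rewrite (bigD1 k) //= Uk big1 ?addr0 // => l lk.
  by case: (boolP (U l x)) => // Ul; rewrite (hU _ _ Ul Uk) eqxx in lk.
by rewrite big1 // => k _; rewrite (negPf (no k)).
Qed.

(** For each seed the hit probabilities sum to at most 3 K / 8, hence so do their averages over the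
    seed; they cannot all be at least 1/2. *)
Lemma fano T (alg : algorithm R T) K (m d : 'I_K -> R) eps :
  sfo_algs alg -> 0 <= eps <= 1 -> 8 * (1 + eps ^+ 2) ^+ T <= K%:R ->
  (forall x k l, `|x - m k| < d k -> `|x - m l| < d l -> k = l) ->
  exists k, (((iid (hard_law eps) T) \x uniform_prob (@ltr01 R))
     [set w | (`|run alg (i := hard (m k) eps) w - m k| < d k)%R] < (2^-1)%:E)%E.
Proof.
move=> sfo e01 MK disj; apply: contrapT => /forallNP no.
have {}no k : ((2^-1)%:E <= ((iid (hard_law eps) T) \x uniform_prob (@ltr01 R))
     [set w | (`|run alg (i := hard (m k) eps) w - m k| < d k)%R])%E.
  by rewrite leNgt; apply/negP/no.
have [q qE] := run_gradsE sfo.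
pose U (k : 'I_K) := [pred x | `|x - m k| < d k].
have hU x : \sum_(k < K) (U k x)%:R <= 1 :> R.
  exact: (@sum_disjoint_le1 K U x (disj x)).
have mA k : measurable [set w | `|run alg (i := hard (m k) eps) w - m k| < d k].
  rewrite -[X in measurable X]setTI.
  apply: (@measurable_fun_ltr _ _ _ setT _ (cst (d k))) => //.
  apply: measurableT_comp => //; apply: measurable_funB => //.
  exact: sfo_sub_so sfo (hard (m k) eps).
(* Measurability in the seed: the hit probability is the measure of a section of a measurable
   event. *)
have mh k : measurable_fun setT
    (fun xi => (hit_prob (q xi) (m k) eps (U k) T [::])%:E).
  have := measurable_fun_ysection (iid (hard_law eps) T) (mA k).
  congr (measurable_fun _ _); apply/funext => xi /=; rewrite -hit_probE //.
  congr (iid (hard_law eps) T _).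
  by apply/seteqP; split => w; rewrite /ysection /= inE /= qE.
have h0 k xi : 0 <= hit_prob (q xi) (m k) eps (U k) T [::].
  by rewrite -lee_fin -hit_probE.
have : (\sum_(k < K) (2^-1)%:E <= (3 / 8 * K%:R : R)%:E)%E.
  apply: (@le_trans _ _ (\sum_(k < K)
      \int[uniform_prob (@ltr01 R)]_xi (hit_prob (q xi) (m k) eps (U k) T [::])%:E)%E).
    apply: lee_sum => k _; apply: le_trans (no k) _.
    rewrite le_eqVlt; apply/orP; left; apply/eqP.
    transitivity (\int[uniform_prob (@ltr01 R)]_xi iid (hard_law eps) T
      [set w | `|run alg (i := hard (m k) eps) (w, xi) - m k| < d k]%R)%E.
      exact: (@prod_ysectionE _ _ _ _ (iid (hard_law eps) T)
        (uniform_prob (@ltr01 R)) _ (mA k)).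
    apply: eq_integral => xi _; rewrite -hit_probE //.
    by congr (iid (hard_law eps) T _); apply/seteqP; split => w /=; rewrite qE.
  rewrite -ge0_integral_sum //; last by move=> k xi _; rewrite lee_fin.
  apply: (@le_trans _ _ (\int[uniform_prob (@ltr01 R)]_xi (cst (3 / 8 * K%:R)%:E xi))%E).
    apply: ge0_le_integral => //.
    - by move=> xi _; apply: sume_ge0 => k _; rewrite lee_fin.
    - exact: emeasurable_sum.
    - move=> xi _ /=; rewrite sumEFin lee_fin; exact: hit_prob_sum.
  rewrite integral_cst // [X in (_ * X)%E](_ : _ = 1%E) ?mule1 //.
  exact: (@probability_setT _ _ _ (uniform_prob (@ltr01 R))).
(* This forces K > 0, so that K / 2 <= 3 K / 8 is absurd. *)
have M0 : 0 < (1 + eps ^+ 2) ^+ T by rewrite exprn_gt0 // ltr_wpDr ?sqr_ge0.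
by rewrite sumEFin lee_fin sumr_const card_ord -mulr_natl; lra.
Qed.

End fano.

(** * Projected stochastic gradient descent *)

Section sgd.
Context {R : realType}.
Implicit Types (b eta x g : R) (z : seq (sample_fun R)).

(** For b >= 0, the projection onto [-b, b]. *)
Definition clip b x : R := Num.max (- b) (Num.min b x).

Lemma clip_norm b x : 0 <= b -> `|clip b x| <= b.
Proof.
move=> b0; rewrite ler_norml /clip le_max lexx /= ge_max ge_min lexx /= andbT.
lra.
Qed.

Lemma clip_dist b x c : `|c| <= b -> (clip b x - c) ^+ 2 <= (x - c) ^+ 2.
Proof.
rewrite ler_norml => /andP[c1 c2]; rewrite -(ler_pM2l (ltr0n _ 2)).
rewrite /clip; case: (leP b x) => bx.
  by rewrite max_r; [nra|lra].
by case: (leP (- b) x) => xb //; nra.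
Qed.

Lemma measurable_clip b : measurable_fun setT (clip b).
Proof.
apply: (@measurable_maxr _ _ _ _ (cst (- b))) => //.
exact: (@measurable_minr _ _ _ _ (cst b)).
Qed.

Definition sgd_step b eta x g : R := clip b (x - eta * g).

(** The queried points; the point reached after the last gradient is not among them. *)
Fixpoint sgd_path b eta x z : seq R :=
  if z is f :: z' then x :: sgd_path b eta (sgd_step b eta x (sf_grad f x)) z'
  else [::].

Lemma size_sgd_path b eta x z : size (sgd_path b eta x z) = size z.
Proof. by elim: z x => //= f z IH x; rewrite IH. Qed.

Definition sgd_alg b eta T : algorithm R T :=
  fun s _ => (\sum_(y <- sgd_path b eta 0 s) y) / T%:R.

Definition null_sample : sample_fun R := SampleFun id id.

Fixpoint sgd_seq b eta x z t : R :=
  if t is t'.+1 then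
    sgd_step b eta (sgd_seq b eta x z t')
      (sf_grad (nth null_sample z t') (sgd_seq b eta x z t'))
  else x.

Lemma sgd_seq_cons b eta x f z t : sgd_seq b eta x (f :: z) t.+1 =
  sgd_seq b eta (sgd_step b eta x (sf_grad f x)) z t.
Proof. by elim: t => //= t IH; rewrite -IH. Qed.

Lemma sgd_pathE b eta x z :
  sgd_path b eta x z = mkseq (sgd_seq b eta x z) (size z).
Proof.
elim: z x => //= f z IH x; rewrite /mkseq /= (iotaDl 1 0) -map_comp IH.
by congr (_ :: _); apply: eq_map => t; rewrite -sgd_seq_cons.
Qed.

Lemma sgd_seq_foldl b eta x z t :
  foldl (sgd_step b eta) x
    (mkseq (fun j => sf_grad (nth null_sample z j) (sgd_seq b eta x z j)) t)
  = sgd_seq b eta x z t.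
Proof. by elim: t => // t IH; rewrite mkseqS foldl_rcons IH. Qed.

Lemma measurable_sgd_step b eta : measurable_fun setT (fun p : R * R =>
  sgd_step b eta p.1 p.2).
Proof.
apply: (measurableT_comp (measurable_clip b)).
by apply: measurable_funB => //; exact: measurable_funM.
Qed.

Lemma measurable_sgd_foldl b eta t j : (j <= t)%N ->
  measurable_fun setT (fun u : t.-tuple R * R =>
    foldl (sgd_step b eta) 0 (take j u.1)).
Proof.
elim: j => [|j IH] jt.
  by under eq_fun do rewrite take0; exact: measurable_cst.
rewrite (_ : (fun u => _) = (fun p => sgd_step b eta p.1 p.2) \o
    (fun u : t.-tuple R * R =>
      (foldl (sgd_step b eta) 0 (take j u.1), tnth u.1 (Ordinal jt)))); last first.
  apply/funext => u /=.
  by rewrite (take_nth 0) ?size_tuple // foldl_rcons (tnth_nth 0).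
apply: (measurableT_comp (measurable_sgd_step b eta)).
apply: measurable_fun_pair; first exact: IH (ltnW jt).
exact: measurableT_comp (measurable_tnth _) measurable_fst.
Qed.

Lemma sgd_sfo b eta T : (0 < T)%N -> sfo_algs (sgd_alg b eta (T := T)).
Proof.
move=> T0; pose run_to (u : seq R) := foldl (sgd_step b eta) 0 u.
pose avg (u : seq R) := (\sum_(j < T) run_to (take j u)) / T%:R.
(* A first-order method must output its iterate at time T. So step T returns the average,
   recomputing the queried points from the prefixes of the gradient history. *)
exists (fun t (u : t.-tuple R * R) => if t == T then avg u.1 else run_to u.1).
  move=> t; have [->|_] := eqVneq t T.
    apply: measurable_funM => //; apply: measurable_sum => j.
    exact: measurable_sgd_foldl (ltnW (ltn_ord j)).
  rewrite (_ : (fun u => _) = fun u : t.-tuple R * R => run_to (take t u.1)).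
    exact: measurable_sgd_foldl.
  by apply/funext => u; rewrite take_oversize ?size_tuple.
move=> z xi; pose y := sgd_seq b eta 0 z.
pose g j := sf_grad (nth null_sample z j) (y j).
exists (fun t => if t == T then sgd_alg b eta z xi else y t); split.
- by rewrite ifF //; apply/eqP => T00; rewrite -T00 in T0.
- move=> t; set u := mktuple _.
  have -> : tval u = mkseq g t.+1.
    rewrite /mkseq -[iota 0 t.+1]val_enum_ord -map_comp.
    apply: eq_map => j /=; rewrite (tnth_nth null_sample) /=.
    by case: eqVneq => // jT; have := leq_trans (ltn_ord j) (ltn_ord t);
      rewrite jT ltnn.
  case: eqVneq => tT; last by rewrite /run_to sgd_seq_foldl.
  rewrite /sgd_alg sgd_pathE size_tuple big_map /avg; congr (_ / _).
  rewrite -[in RHS](big_mkord xpredT (fun j => run_to (take j (mkseq g t.+1)))).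
  rewrite /index_iota subn0 !big_seq; apply: eq_bigr => j.
  rewrite mem_iota add0n => /= jT; rewrite /run_to /mkseq -map_take take_iota.
  by rewrite tT (minn_idPl (ltnW jT)) -[map _ _]/(mkseq g j) sgd_seq_foldl.
- by rewrite eqxx.
Qed.

End sgd.

(** * Regularity of the Lipschitz class, Jensen's inequality, a quadratic bound on exp *)

Section regular.
Context {R : realType}.
Implicit Types (i : instance R) (x y r : R).

Lemma lip_class_dist r i x y s : lip_class 1 r i ->
  `|inst_fun i x s - inst_fun i y s| <= `|x - y|.
Proof. by move=> [_ /(_ s (x, y)) /= + _]; rewrite mul1r; apply. Qed.

Lemma lip_class_grad r i x s : lip_class 1 r i -> `|inst_grad i x s| <= 1.
Proof.
move=> ii; have [cvx _ _] := ii.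
have := inst_subgradient (cvx s) x (x + 1).
have := inst_subgradient (cvx s) x (x - 1).
have := lip_class_dist (x + 1) x s ii; have := lip_class_dist (x - 1) x s ii.
rewrite (_ : x - 1 - x = -1); last by ring.
rewrite (_ : x + 1 - x = 1); last by ring.
rewrite normrN1 normr1 !ler_norml => /andP[? ?] /andP[? ?] ? ?.
by apply/andP; split; lra.
Qed.

Lemma integrable_fun i x :
  (inst_law i).-integrable setT (EFin \o inst_fun i x).
Proof. exact: inst_integrable. Qed.

Lemma law_setT i : fine (inst_law i setT) = 1.
Proof. by rewrite probability_setT. Qed.

Lemma objective_dist r i x y : lip_class 1 r i ->
  `|objective i x - objective i y| <= `|x - y|.
Proof.
move=> ii.
have main x' y' : objective i x' <= objective i y' + `|x' - y'|.
  rewrite !objectiveE -[X in _ <= _ + X]mulr1 -(law_setT i) -Rintegral_cst //.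
  have ic : (inst_law i).-integrable setT (EFin \o cst `|x' - y'|).
    exact: finite_measure_integrable_cst.
  rewrite -RintegralD //; last exact: integrable_fun.
  apply: le_Rintegral => //; first exact: integrable_fun.
    by apply: eq_integrable (integrableD _ (integrable_fun i y') ic).
  move=> s _; have := lip_class_dist x' y' s ii; rewrite ler_norml.
  by move=> /andP[_]; rewrite lerBlDl addrC.
have := main x y; have := main y x; rewrite (distrC y x) ler_norml.
by move=> ? ?; apply/andP; split; lra.
Qed.

Lemma measurable_objective r i : lip_class 1 r i ->
  measurable_fun setT (objective i).
Proof.
move=> ii; apply: continuous_measurable_fun => x.
apply/cvgrPdist_lt => e e0; near=> y.
apply: le_lt_trans (objective_dist x y ii) _.
near: y; exact: cvgr_dist_lt.
Unshelve. all: by end_near. Qed.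

(** Jensen's inequality, sample by sample: the linear terms of the subgradient inequality at the
    mean [a] sum to zero over [l]. *)
Lemma objective_mean r i (l : seq R) : lip_class 1 r i -> (0 < size l)%N ->
  (size l)%:R * objective i ((\sum_(y <- l) y) / (size l)%:R)
    <= \sum_(y <- l) objective i y.
Proof.
move=> ii l0; have [cvx _ _] := ii.
set a := (_ / _); have l0' : (size l)%:R != 0 :> R by rewrite pnatr_eq0 -lt0n.
have isum (l' : seq R) : (inst_law i).-integrable setT
      (EFin \o (fun s => \sum_(y <- l') inst_fun i y s)) /\
    (\int[inst_law i]_s (\sum_(y <- l') inst_fun i y s))%R =
      \sum_(y <- l') objective i y.
  elim: l' => [|y l' [IH1 IH2]].
    rewrite (_ : (fun s => _) = cst 0); last by apply/funext => s; rewrite big_nil.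
    rewrite big_nil Rintegral_cst // mul0r; split => //.
    exact: finite_measure_integrable_cst.
  rewrite (_ : (fun s => _) =
      (fun s => inst_fun i y s + \sum_(y <- l') inst_fun i y s)); last first.
    by apply/funext => s; rewrite big_cons.
  split; first by apply: eq_integrable (integrableD _ (integrable_fun i y) IH1).
  by rewrite RintegralD // ?IH2 ?big_cons ?objectiveE //; exact: integrable_fun.
have [int_l <-] := isum l; have [int_n sum_n] := isum (nseq (size l) a).
have -> : (size l)%:R * objective i a = \sum_(y <- nseq (size l) a) objective i y.
  by rewrite big_nseq iter_addr_0 mulr_natl.
rewrite -sum_n; apply: le_Rintegral => // s _.
rewrite big_nseq iter_addr_0 -mulr_natl.
have sumE : \sum_(y <- l) (inst_fun i a s + inst_grad i a s * (y - a)) =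
    (size l)%:R * inst_fun i a s.
  rewrite big_split /= -mulr_sumr sumrB !big_const_seq !count_predT !iter_addr_0.
  by rewrite -[a *+ _]mulr_natl /a mulrCA divff // mulr1 subrr mulr0 addr0 mulr_natl.
rewrite -sumE; apply: ler_sum => y _; exact: inst_subgradient (cvx s) a y.
Qed.

(** For x <= 0, (1 - x) exp x <= 1 and (1 - x) (1 + x + x^2) = 1 - x^3 >= 1. For x > 0, (1 - x/2)^2
    exp x <= 1 and (1 - x/2)^2 (1 + x + x^2) >= 1, which is where x <= 1/3 enters. *)
Lemma expR_le_quad x : x <= 3^-1 -> expR x <= 1 + x + x ^+ 2.
Proof.
move=> x3; have /ltW ex0 := expR_gt0 x.
have := expR_ge1Dx (- x); rewrite expRN; have := expR_gt0 x => ex.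
have [x0|x0] := lerP x 0.
  rewrite -(ler_pM2r ex) mulVf ?gt_eqF // => H.
  have H' : (1 + x + x ^+ 2) * ((1 - x) * expR x) <= 1 + x + x ^+ 2.
    by rewrite -[leRHS]mulr1 ler_wpM2l //; nra.
  apply: le_trans H'; rewrite mulrA ler_peMl // -subr_ge0.
  rewrite (_ : _ - 1 = (- x) ^+ 3); last by ring.
  by rewrite exprn_ge0 // oppr_ge0.
move=> _; have := expR_ge1Dx (- (x / 2)); rewrite expRN => H.
have {}H : expR (x / 2) * (1 - x / 2) <= 1.
  by rewrite -(ler_pM2l (expR_gt0 (x / 2))) mulfV ?gt_eqF ?expR_gt0 // in H.
have h0 : 0 <= expR (x / 2) * (1 - x / 2) by rewrite mulr_ge0 ?expR_ge0 //; lra.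
have {}H : expR x * (1 - x / 2) ^+ 2 <= 1.
  rewrite [X in expR X](_ : x = x / 2 + x / 2); last by field.
  rewrite expRD (_ : _ * _ = (expR (x / 2) * (1 - x / 2)) ^+ 2); last by ring.
  by rewrite expr_le1.
have p0 : 0 <= 1 + x + x ^+ 2 by rewrite expr2; nra.
have {}H : expR x * (1 - x / 2) ^+ 2 * (1 + x + x ^+ 2) <= 1 + x + x ^+ 2.
  by rewrite ler_piMl.
apply: le_trans H; rewrite -mulrA ler_peMr // -subr_ge0.
rewrite (_ : _ - 1 = x ^+ 2 / 4 * (1 - 3 * x + x ^+ 2)); last by field.
by rewrite mulr_ge0 // ?mulr_ge0 ?sqr_ge0 //; have := sqr_ge0 x; lra.
Qed.

End regular.

(** * Exponential moments of the regret of projected SGD *)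

Section potential.
Context {R : realType}.
Variables (i : instance R) (r b eta lambda xs : R).
Hypotheses (ii : lip_class 1 r i) (xs_b : `|xs| <= b)
  (eta0 : 0 < eta) (lambda0 : 0 < lambda)
  (lambda_b : lambda * (2 * b) <= 3^-1).

Let b0 : 0 <= b. Proof. exact: le_trans (normr_ge0 _) xs_b. Qed.

Let S := inst_space i.
Let gap x := objective i x - objective i xs.
Let next x s := sgd_step b eta x (inst_grad i x s).

(** The gaps are those of the objective, not of the samples. Recursion on the samples lets the first
    draw be integrated out. *)
Fixpoint regret x (w : seq S) : R :=
  if w is s :: w' then gap x + regret (next x s) w' else 0.

Lemma regretE x w : regret x w =
  \sum_(y <- sgd_path b eta x (map (@sample_of R i) w)) gap y.
Proof. by elim: w x => [|s w IH] x /=; rewrite ?big_nil ?big_cons ?IH. Qed.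

Lemma measurable_regret n :
  measurable_fun setT (fun p : R * n.-tuple S => regret p.1 p.2).
Proof.
elim: n => [|n IH].
  rewrite (_ : (fun p => _) = cst 0) ?measurable_cst //.
  by apply/funext => -[x w] /=; rewrite tuple0.
rewrite (_ : (fun p => _) = (fun p : R * n.+1.-tuple S => gap p.1 +
    ((fun p : R * n.-tuple S => regret p.1 p.2) \o
     (fun p : R * n.+1.-tuple S =>
       (next p.1 (tnth p.2 ord0), [tuple of behead p.2]))) p)); last first.
  by apply/funext => -[x w] /=; case/tupleP: w => s w.
apply: measurable_funD.
  apply: measurable_funB => //.
  exact: measurableT_comp (measurable_objective ii) measurable_fst.
apply: (measurableT_comp IH); apply: measurable_fun_pair; last first.
  exact: (measurableT_comp (@measurable_behead (inst_disp i) S n) measurable_snd).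
rewrite (_ : (fun p => _) = (fun p : R * R => sgd_step b eta p.1 p.2) \o
    (fun p : R * n.+1.-tuple S => (p.1, inst_grad i p.1 (tnth p.2 ord0)))) //.
apply: (measurableT_comp (measurable_sgd_step b eta)).
apply: measurable_fun_pair => //.
rewrite (_ : (fun p => _) = (fun p : R * S => inst_grad i p.1 p.2) \o
    (fun p : R * n.+1.-tuple S => (p.1, tnth p.2 ord0))) //.
apply: (measurableT_comp (@inst_measurable_grad R i)).
apply: measurable_fun_pair => //.
exact: measurableT_comp (measurable_tnth _) measurable_snd.
Qed.

Lemma measurable_regret_at n x :
  measurable_fun setT (fun w : n.-tuple S => regret x w).
Proof.
have mx : measurable_fun setT (fun w : n.-tuple S => (x, w)).
  exact: measurable_fun_pair.
exact: measurableT_comp (@measurable_regret n) mx.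
Qed.

Lemma measurable_exp_regret n x :
  measurable_fun setT (fun w : n.-tuple S => (expR (lambda * regret x w))%:E).
Proof.
apply/measurable_EFinP; apply: measurableT_comp => //.
by apply: measurable_funM => //; exact: measurable_regret_at.
Qed.

Let diff x s := inst_fun i x s - inst_fun i xs s.

Let measurable_diff x : measurable_fun setT (diff x).
Proof.
apply: measurable_funB;
  by case/integrableP: (integrable_fun i x);
    case/integrableP: (integrable_fun i xs) => /measurable_EFinP ? _ /measurable_EFinP ? _.
Qed.

(** [expR_le_quad] applies since |lambda diff| <= 2 b lambda <= 1/3. The linear term has mean -
    lambda gap, and 1 + u <= exp u concludes. *)
Lemma mgf_diff x : `|x| <= b ->
  (\int[inst_law i]_s (expR (- lambda * diff x s))%:E
    <= (expR (- lambda * gap x + (lambda * (2 * b)) ^+ 2))%:E)%E.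
Proof.
move=> xb; set c := (lambda * (2 * b)) ^+ 2.
have diff_b s : `|diff x s| <= 2 * b.
  apply: le_trans (lip_class_dist x xs s ii) _.
  by apply: le_trans (ler_normB _ _) _; rewrite mulr_natl mulr2n lerD.
have ldiff s : `|- lambda * diff x s| <= lambda * (2 * b).
  by rewrite normrM normrN (gtr0_norm lambda0) ler_pM2l.
have int_diff : (inst_law i).-integrable setT (EFin \o diff x).
  exact: eq_integrable (integrableB _ (integrable_fun i x) (integrable_fun i xs)).
have int_ldiff : (inst_law i).-integrable setT (EFin \o (fun s => - lambda * diff x s)).
  by apply: eq_integrable (integrableZl measurableT (- lambda) int_diff).
have int_cst : (inst_law i).-integrable setT (EFin \o cst (1 + c)).
  exact: finite_measure_integrable_cst.
have int_lin : (inst_law i).-integrable setT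
    (EFin \o (fun s => - lambda * diff x s + cst (1 + c) s)).
  by apply: eq_integrable (integrableD _ int_ldiff int_cst).
apply: (@le_trans _ _
  (\int[inst_law i]_s (- lambda * diff x s + cst (1 + c) s)%:E)%E).
  apply: ge0_le_integral => //.
  - apply/measurable_EFinP; apply: measurableT_comp => //.
    exact: measurable_funM.
  - exact: measurable_int int_lin.
  - move=> s _; rewrite lee_fin.
    apply: le_trans (expR_le_quad _) _.
      by apply: le_trans (ler_norm _) (le_trans (ldiff s) lambda_b).
    have : (- lambda * diff x s) ^+ 2 <= c.
      rewrite /c -real_normK ?num_real // ler_pXn2r ?nnegrE //.
      by rewrite mulr_ge0 ?mulr_ge0 // ltW.
    by rewrite /cst; lra.
rewrite -(@fineK _ (\int[_]_ _ _)%E); last exact: integrable_fin_num.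
rewrite lee_fin -/(Rintegral _ _ _) RintegralD // Rintegral_cst // law_setT mulr1.
rewrite RintegralZl // /diff RintegralB //;
  [|exact: integrable_fun|exact: integrable_fun].
rewrite -!objectiveE -/(gap x).
apply: le_trans (expR_ge1Dx _); rewrite le_eqVlt; apply/orP; left; apply/eqP.
ring.
Qed.

Let theta := lambda / (2 * eta).

(** The one-step inequality of SGD: projecting does not increase the distance to [xs], the
    subgradient inequality bounds the cross term, and theta turns its factor 2 eta into lambda. *)
Lemma next_dist x s : theta * (next x s - xs) ^+ 2 <=
  theta * (x - xs) ^+ 2 - lambda * diff x s + theta * eta ^+ 2.
Proof.
have [cvx _ _] := ii; have th0 : 0 < theta by rewrite divr_gt0 // mulr_gt0.
have lE : lambda = theta * (2 * eta) by rewrite /theta; field; rewrite gt_eqF.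
have h1 := inst_subgradient (cvx s) x xs.
have h2 := clip_dist (x - eta * inst_grad i x s) xs_b.
have h3 : inst_grad i x s ^+ 2 <= 1.
  by rewrite -real_normK ?num_real // expr_le1 //; exact: lip_class_grad ii.
rewrite -/(sgd_step b eta x _) -/(next x s) in h2.
rewrite {1}lE -mulrA -mulrBr -mulrDr ler_pM2l //; apply: le_trans h2 _.
set g := inst_grad i x s in h1 h3 *.
have -> : (x - eta * g - xs) ^+ 2 =
  (x - xs) ^+ 2 + 2 * eta * (g * (xs - x)) + eta ^+ 2 * g ^+ 2 by ring.
have : eta ^+ 2 * g ^+ 2 <= eta ^+ 2 * 1 by rewrite ler_wpM2l ?sqr_ge0.
have : 2 * eta * (g * (xs - x)) <= 2 * eta * (- diff x s).
  by rewrite ler_wpM2l ?mulr_ge0 ?(ltW eta0) // /diff; move: h1 => /=; lra.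
lra.
Qed.

(* The induction runs backwards in time, with exp (lambda regret +
   theta (x - xs)^2) as potential; theta = lambda / (2 eta) makes the cross term
   of the squared distance cancel against the regret in expectation. *)
Lemma regret_mgf n x : `|x| <= b ->
  (\int[iid (inst_law i) n]_w (expR (lambda * regret x w))%:E <=
   (expR (theta * (x - xs) ^+ 2 +
      n%:R * ((lambda * (2 * b)) ^+ 2 + theta * eta ^+ 2)))%:E)%E.
Proof.
set c := (_ ^+ 2 + _); elim: n x => [|n IH] x xb.
  apply: (@le_trans _ _ (\int[iid (inst_law i) 0]_w (cst 1%:E w))%E).
    apply: ge0_le_integral => //.
    - exact: measurable_exp_regret.
    - by move=> w _; rewrite tuple0 /= mulr0 expR0.
  rewrite integral_cst // [X in (_ * X)%E](_ : _ = 1%E) ?mule1; last first.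
    exact: probability_setT.
  rewrite lee_fin mul0r addr0 -expR0 ler_expR.
  by rewrite mulr_ge0 ?sqr_ge0 // ltW // divr_gt0 // mulr_gt0.
have mcons : measurable_fun setT (fun p : S * n.-tuple S =>
    (expR (lambda * (gap x + regret (next x p.1) p.2)))%:E).
  exact: (measurableT_comp (@measurable_exp_regret n.+1 x)
    (@measurable_cons_pair _ S n)).
rewrite /= ge0_integral_pushforward //=; last exact: measurable_exp_regret n.+1 x.
rewrite preimage_setT fubini_tonelli1 //=.
(* [C] gathers what does not depend on the first draw once [next_dist] is applied. Only exp (-
   lambda diff) is left to integrate; its bound cancels the term lambda gap of [C]. *)
pose C := lambda * gap x + theta * (x - xs) ^+ 2 + theta * eta ^+ 2 + n%:R * c.
apply: (@le_trans _ _
  (\int[inst_law i]_s ((expR C)%:E * (expR (- lambda * diff x s))%:E))%E).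
  apply: ge0_le_integral => //.
  - by move=> s _; apply: integral_ge0 => w _; rewrite lee_fin expR_ge0.
  - exact: measurable_fun_fubini_tonelli_F.
  - apply: emeasurable_funM => //; apply/measurable_EFinP; apply: measurableT_comp => //.
    exact: measurable_funM.
  - move=> s _; rewrite /fubini_F /=.
    have mnext := @measurable_exp_regret n (next x s).
    under eq_integral => w _ do rewrite mulrDr expRD EFinM.
    rewrite ge0_integralZl_EFin ?expR_ge0 //.
    apply: (@le_trans _ _ ((expR (lambda * gap x))%:E *
      (expR (theta * (next x s - xs) ^+ 2 + n%:R * c))%:E)%E).
      by rewrite lee_wpmul2l ?lee_fin ?expR_ge0 // IH // clip_norm.
    rewrite -!EFinM -!expRD lee_fin ler_expR.
    by have := next_dist x s; rewrite /C; lra.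
rewrite ge0_integralZl_EFin ?expR_ge0 //; last first.
  by apply/measurable_EFinP; apply: measurableT_comp => //; exact: measurable_funM.
apply: (@le_trans _ _ ((expR C)%:E *
   (expR (- lambda * gap x + (lambda * (2 * b)) ^+ 2))%:E)%E).
  by rewrite lee_wpmul2l ?lee_fin ?expR_ge0 //; exact: mgf_diff.
rewrite -EFinM -expRD lee_fin ler_expR /C -natr1 /c; lra.
Qed.

(** Markov's inequality for exp (lambda regret), started at 0. *)
Lemma regret_tail n delta B : 0 < delta ->
  theta * xs ^+ 2 + n%:R * ((lambda * (2 * b)) ^+ 2 + theta * eta ^+ 2)
    + ln delta^-1 <= lambda * B ->
  (iid (inst_law i) n [set w : n.-tuple S | (B < regret 0 w)%R] <= delta%:E)%E.
Proof.
move=> d0 hB; set A := [set w | _].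
have mreg : measurable_fun setT (fun w : n.-tuple S => regret 0 w).
  exact: measurable_regret_at.
have mA : measurable A.
  rewrite -[X in measurable X]setTI.
  exact: (@measurable_fun_ltr _ _ _ setT (cst B)).
have : ((expR (lambda * B))%:E * iid (inst_law i) n A <=
    (expR (lambda * B) * delta)%:E)%E.
  apply: (@le_trans _ _ (\int[iid (inst_law i) n]_w (expR (lambda * regret 0 w))%:E)%E).
    rewrite -(setIT A) -integral_indic // -ge0_integralZl_EFin ?expR_ge0 //; last first.
      exact/measurable_EFinP.
    apply: ge0_le_integral => //.
    - by apply: emeasurable_funM => //; exact/measurable_EFinP.
    - exact: measurable_exp_regret.
    - move=> w _; rewrite -EFinM lee_fin indicE.
      have [/set_mem /= Bw|_] := boolP (w \in A); last by rewrite mulr0 expR_ge0.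
      by rewrite mulr1 ler_expR ler_pM2l // ltW.
  apply: le_trans (regret_mgf n _) _; first by rewrite normr0.
  rewrite lee_fin sub0r sqrrN -(@lnK _ delta) ?posrE // -expRD ler_expR.
  by move: hB; rewrite lnV //; lra.
by rewrite EFinM lee_pmul2l ?lte_fin ?expR_gt0.
Qed.

End potential.

(** * High-probability upper bound on the minimax error *)

Section upper.
Context {R : realType}.
Implicit Types (i : instance R) (r delta : R).

Lemma err_le T delta (alg : algorithm R T) i xs B :
  argmin (objective i) xs ->
  ((1 - delta)%:E <= (iid (inst_law i) T \x uniform_prob (@ltr01 R))
     [set w | (objective i (run alg w) <= objective i xs + B)%R])%E ->
  (err delta alg i <= B%:E)%E.
Proof.
move=> xm h; rewrite /err (inf_argmin xm) leeBlDr //.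
by apply: ge_ereal_inf; exists (objective i xs + B)%:E;
  [exists (objective i xs + B)|rewrite -EFinD addrC].
Qed.

Lemma ln2_ge : 2^-1 <= ln 2 :> R.
Proof.
have := expR_ge1Dx (- 2^-1 : R); rewrite expRN => h.
have {}h : expR 2^-1 <= 2 :> R.
  by rewrite -lef_pV2 ?posrE ?expR_gt0 //; lra.
by rewrite -ler_expR lnK ?posrE.
Qed.

Lemma ln_inv_ge delta : 0 < delta <= 2^-1 -> 2^-1 <= ln delta^-1.
Proof.
move=> /andP[d0 d2]; apply: le_trans ln2_ge _.
rewrite ler_ln ?posrE ?invr_gt0 // -[leLHS]invrK lef_pV2 ?posrE ?invr_gt0 //.
Qed.

Definition zero_alg T : algorithm R T := fun _ _ => 0.

Lemma zero_sfo T : sfo_algs (@zero_alg T).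
Proof. by exists (fun _ _ => 0) => [t|z xi]; last by exists (fun=> 0). Qed.

Lemma zero_err T delta i r : 0 < r -> 0 <= delta -> lip_class 1 r i ->
  (err delta (@zero_alg T) i <= (2 * r)%:E)%E.
Proof.
move=> r0 d0 ii; have [xs xm xsr] := lip_class_argmin ii r0.
apply: (err_le xm); rewrite [X in (_ <= _ X)%E](_ : _ = setT); last first.
  apply/seteqP; split => // w _ /=; rewrite /run /zero_alg.
  have := objective_dist 0 xs ii; rewrite sub0r normrN ler_norml; lra.
have -> : ((iid (inst_law i) T \x uniform_prob (@ltr01 R)) setT = 1)%E.
  exact: probability_setT.
by rewrite lee_fin; lra.
Qed.

(** The radius 2 r contains a minimizer, by [lip_class_argmin] with slack r. The regret exceeds 9 b
    sig T with probability at most delta; Jensen's inequality passes to the average. *)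
Lemma sgd_err T delta i r : (0 < T)%N -> 0 < r -> 0 < delta <= 2^-1 ->
  ln delta^-1 <= T%:R -> lip_class 1 r i ->
  (err delta (sgd_alg (2 * r) (2 * r / Num.sqrt T%:R) (T := T)) i
     <= (18 * r * Num.sqrt (ln delta^-1 / T%:R))%:E)%E.
Proof.
move=> T0 r0 /[dup] d2 /andP[d0 _] DT ii; have D2 := ln_inv_ge d2.
have [xs xm xsr] := lip_class_argmin ii r0.
set D := ln delta^-1 in DT D2 *; set b := 2 * r; set eta := b / _.
have xsb : `|xs| <= b by rewrite /b; lra.
have Tp : 0 < T%:R :> R by rewrite ltr0n.
have D0 : 0 < D by lra.
have b0 : 0 < b by rewrite mulr_gt0.
set t := Num.sqrt (T%:R : R) in eta *; set sig := Num.sqrt (D / T%:R).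
have t0 : 0 < t by rewrite sqrtr_gt0.
have s0 : 0 < sig by rewrite sqrtr_gt0 divr_gt0.
have tE : t ^+ 2 = T%:R by rewrite sqr_sqrtr ?ltW.
have sE : sig ^+ 2 * t ^+ 2 = D.
  by rewrite tE sqr_sqrtr ?divfK ?gt_eqF // ltW // divr_gt0.
have s1 : sig <= 1.
  by rewrite -[leRHS]sqrtr1 ler_sqrt // ler_pdivrMr // mul1r.
(* Here (sig t)^2 = D >= 1/2; the value 3/7 is what the last inequality on the regret requires. *)
have st : 3 / 7 <= sig * t.
  rewrite -ler_sqr ?nnegrE ?mulr_ge0 ?(ltW s0) ?(ltW t0) // [leRHS]exprMn sE expr2; lra.
have eta0 : 0 < eta by rewrite divr_gt0.
(* Makes 2 b lambda = sig / 3, which is at most 1/3 because D <= T. *)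
pose lambda := sig / (6 * b).
have l0 : 0 < lambda by rewrite divr_gt0 // mulr_gt0.
have lb : lambda * (2 * b) <= 3^-1.
  have -> : lambda * (2 * b) = sig / 3 by rewrite /lambda; field; rewrite gt_eqF.
  lra.
have alg_sfo := @sgd_sfo R b eta T T0.
have mrun : measurable_fun setT (run (sgd_alg b eta (T := T)) (i := i)).
  exact: sfo_sub_so alg_sfo i.
have tail : (iid (inst_law i) T [set w : T.-tuple (inst_space i) |
    (T%:R * (9 * b * sig) < regret b eta xs 0 w)%R] <= delta%:E)%E.
  apply: (regret_tail ii xsb eta0 l0 lb) => //; rewrite -/D.
  apply: (@le_trans _ _ (lambda / (2 * eta) * b ^+ 2 +
      T%:R * ((lambda * (2 * b)) ^+ 2 + lambda / (2 * eta) * eta ^+ 2) + D)).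
    have x2 : xs ^+ 2 <= b ^+ 2.
      by rewrite -real_normK ?num_real // ler_sqr ?nnegrE // ltW.
    rewrite !lerD2r ler_wpM2l //.
    by apply: divr_ge0; [exact: ltW|apply: mulr_ge0 => //; exact: ltW].
  (* In terms of y = sig t, with y^2 = D, the claim is y / 6 + (10 / 9) y^2 <= (3 / 2) y^2. *)
  rewrite -tE /lambda /eta -sE -subr_ge0.
  rewrite (_ : _ - _ = (sig * t) * (7 / 18 * (sig * t) - 6^-1)); last first.
    by field; rewrite ?gt_eqF.
  by apply: mulr_ge0; [apply: mulr_ge0; exact: ltW|lra].
rewrite (_ : 18 * r * sig = 9 * b * sig); last by rewrite /b; ring.
apply: (err_le xm).
set A := [set w : T.-tuple (inst_space i) |
  T%:R * (9 * b * sig) < regret b eta xs 0 w] in tail.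
have mA : measurable A.
  rewrite -[X in measurable X]setTI.
  apply: (@measurable_fun_ltr _ _ _ setT (cst _)) => //.
  exact: (@measurable_regret_at R i r b eta xs ii).
apply: (@le_trans _ _
  ((iid (inst_law i) T \x uniform_prob (@ltr01 R)) (~` A `*` setT))%E).
  rewrite product_measure1E //; last exact: measurableC.
  rewrite [X in (_ * X)%E](_ : _ = 1%E); last first.
    exact: (@probability_setT _ _ _ (uniform_prob (@ltr01 R))).
  rewrite mule1; apply: (@le_trans _ _ (1 - iid (inst_law i) T A)%E).
    by rewrite EFinB leeB.
  rewrite le_eqVlt; apply/orP; left; apply/eqP/esym.
  exact: (probability_setC (iid (inst_law i) T) mA).
apply: le_measure; rewrite ?inE //.
- by apply: measurableX => //; exact: measurableC.
- rewrite -[X in measurable X]setTI.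
  apply: (@measurable_fun_ler _ _ _ setT _ (cst _)) => //.
  exact: measurableT_comp (measurable_objective ii) mrun.
- move=> [w xi] [/= /negP]; rewrite -leNgt => Aw _.
  rewrite -(ler_pM2l Tp) mulrDr; rewrite (regretE b eta xs 0 w) sumrB in Aw.
  have sz : size (sgd_path b eta 0 (map (sample_of (i := i)) w)) = T.
    by rewrite size_sgd_path size_map size_tuple.
  rewrite big_const_seq count_predT sz iter_addr_0 -mulr_natl in Aw.
  have := objective_mean (l := sgd_path b eta 0 (map (sample_of (i := i)) w)) ii.
  rewrite sz => /(_ T0) H.
  have -> : run (sgd_alg b eta (T := T)) (w, xi) =
    (\sum_(y <- sgd_path b eta 0 (map (sample_of (i := i)) w)) y) / T%:R by [].
  by lra.
Qed.

(** SGD when log (1 / delta) <= T. Otherwise the square root is at least 1, and the error 2 r of the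
    constant output 0 is small enough. *)
Lemma minimax_err_upper T delta r : (0 < T)%N -> 0 < r -> 0 < delta <= 2^-1 ->
  (minimax_err delta (sfo_algs (T := T)) (lip_class 1 r)
     <= (18 * r * Num.sqrt (ln delta^-1 / T%:R))%:E)%E.
Proof.
move=> T0 r0 d2; have Tp : 0 < T%:R :> R by rewrite ltr0n.
have [DT|/ltW TD] := leP (ln delta^-1) (T%:R : R).
  apply: ge_ereal_inf; exists (class_err delta
      (sgd_alg (2 * r) (2 * r / Num.sqrt T%:R) (T := T)) (lip_class 1 r)).
    exists (sgd_alg (2 * r) (2 * r / Num.sqrt T%:R) (T := T)) => //.
    exact: sgd_sfo.
  by apply: ge_ereal_sup => _ [i ii ->]; exact: sgd_err.
apply: ge_ereal_inf; exists (class_err delta (@zero_alg T) (lip_class 1 r)).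
  by exists (@zero_alg T) => //; exact: zero_sfo.
apply: ge_ereal_sup => _ [i ii ->]; case/andP: d2 => d0 _.
apply: le_trans (zero_err T r0 (ltW d0) ii) _; rewrite lee_fin.
have : 1 <= Num.sqrt (ln delta^-1 / T%:R).
  rewrite -[leLHS]sqrtr1 ler_sqrt ?divr_ge0 ?(le_trans _ TD) //.
  by rewrite ler_pdivlMr // mul1r.
by move=> h; nra.
Qed.

End upper.

(** * Price of adaptivity *)

Section poa.
Context {R : realType}.
Implicit Types (rho delta eps : R).

(** The candidate [k] is found before the radius [r], which can then be fitted to it. *)
Lemma fano_class_err T delta (alg : algorithm R T) K (m d : 'I_K -> R) eps :
  sfo_algs alg -> delta <= 2^-1 -> 0 < eps <= 1 ->
  8 * (1 + eps ^+ 2) ^+ T <= K%:R ->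
  (forall x k l, `|x - m k| < d k -> `|x - m l| < d l -> k = l) ->
  exists k, forall r, `|m k| <= r ->
    ((eps * d k)%:E <= class_err delta alg (lip_class 1 r))%E.
Proof.
move=> sfo d2 /[dup] e01 /andP[e0 e1] MK disj.
have e01' : 0 <= eps <= 1 by rewrite ltW.
have [k hk] := fano sfo e01' MK disj; exists k => r mr.
apply: (@le_trans _ _ (err delta alg (hard (m k) eps))).
  apply: hard_err => //; exact: sfo_sub_so sfo (hard (m k) eps).
by apply: ereal_sup_ubound; exists (hard (m k) eps) => //; exact: hard_lip_class.
Qed.

(** Inversion is antitone on the nonnegative extended reals, so an upper bound on the denominator is
    enough, m = 0 included. *)
Lemma lee_ratio (X Y : R) (a m : \bar R) : 0 <= X -> 0 < Y ->
  (X%:E <= a)%E -> (0 <= m <= Y%:E)%E -> ((X / Y)%:E <= a / m)%E.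
Proof.
move=> X0 Y0 Xa /andP[m0 mY]; rewrite EFinM; apply: lee_pmul => //.
  by rewrite lee_fin invr_ge0 ltW.
have -> : (Y^-1)%:E = (Y%:E^-1)%E by rewrite inver gt_eqF.
by rewrite lee_pV2 ?inE ?lee_fin ?(ltW Y0).
Qed.

Lemma minimax_err_class_ge0 T delta (A : set (algorithm R T)) r :
  delta <= 2^-1 -> 0 <= r -> (0 <= minimax_err delta A (lip_class 1 r))%E.
Proof.
move=> d2 r0; apply: (@minimax_err_ge0 _ _ _ _ _ _ (hard 0 0)); first by lra.
by apply: hard_lip_class; rewrite ?lexx ?ler01 ?normr0.
Qed.

Lemma exprn_1Dx_le n (x : R) : 0 <= x -> (1 + x) ^+ n <= expR (n%:R * x).
Proof.
move=> x0; rewrite expRM_natl.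
by rewrite lerXn2r ?nnegrE ?expR_ge0 ?expR_ge1Dx // addr_ge0.
Qed.

(** Keeps the ratio in [poa_ge1] away from 0 / 0; sixteen equally spaced candidates in [0, 1) are
    enough. *)
Lemma class_err_gt0 T delta (alg : algorithm R T) : (0 < T)%N ->
  sfo_algs alg -> delta <= 2^-1 ->
  exists2 X : R, 0 < X & (X%:E <= class_err delta alg (lip_class 1 1))%E.
Proof.
move=> T0 sfo d2; have T1 : 1 <= T%:R :> R by rewrite ler1n.
(* T eps^2 = 1 / (4 T) is below log 2, hence 8 (1 + eps^2)^T <= 16, the number of candidates. *)
pose eps : R := (2 * T%:R)^-1.
have eE : eps * (2 * T%:R) = 1 by rewrite mulVf // gt_eqF //; lra.
have e0 : 0 < eps by rewrite invr_gt0; lra.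
have e1 : eps <= 1 by nra.
pose m (k : 'I_16) : R := k%:R / 16; pose d (k : 'I_16) : R := 32^-1.
have [] := @fano_class_err T delta alg 16 m d eps sfo d2.
- by rewrite e0.
- have := exprn_1Dx_le T (sqr_ge0 eps).
  have : expR (T%:R * eps ^+ 2) <= 2 :> R.
    rewrite -(@lnK _ 2) ?posrE // ler_expR; apply: le_trans ln2_ge.
    by rewrite expr2; nra.
  by lra.
- move=> x k l; rewrite /m /d !ltr_distl => /andP[h1 h2] /andP[h3 h4].
  have kl : (k%:R : R) < (l.+1)%:R by rewrite -natr1; lra.
  have lk : (l%:R : R) < (k.+1)%:R by rewrite -natr1; lra.
  apply/val_inj/eqP; move: kl lk; rewrite !ltr_nat !ltnS => kl lk.
  by rewrite eqn_leq kl lk.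
move=> k /(_ 1) h; exists (eps * d k); first by rewrite mulr_gt0 // invr_gt0.
apply: h; rewrite /m ger0_norm ?divr_ge0 // ler_pdivrMr // mul1r ler_nat.
by rewrite ltnW.
Qed.

Lemma poa_ge1 T delta rho (alg : algorithm R T) : (0 < T)%N -> 1 <= rho ->
  0 < delta <= 2^-1 -> sfo_algs alg ->
  (1 <= poa delta alg (lip_classes 1 rho) (sfo_algs (T := T)))%E.
Proof.
move=> T0 rho1 /[dup] d2 /andP[_ d2'] sfo.
have [X X0 Xa] := class_err_gt0 T0 sfo d2'.
set I := lip_class 1 1 in Xa.
have m0 : (0 <= minimax_err delta (sfo_algs (T := T)) I)%E.
  by apply: minimax_err_class_ge0.
have mY := minimax_err_upper T0 ltr01 d2; rewrite -/I in mY.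
have ma : (minimax_err delta (sfo_algs (T := T)) I <= class_err delta alg I)%E.
  by apply: ereal_inf_lbound; exists alg.
apply: (@le_trans _ _ (class_err delta alg I /
    minimax_err delta (sfo_algs (T := T)) I)%E); last first.
  by apply: ereal_sup_ubound; exists I => //; exists 1, 1; rewrite !lexx rho1.
set Y := 18 * 1 * _ in mY.
have Y1 : (minimax_err delta (sfo_algs (T := T)) I <= (Y + 1)%:E)%E.
  by apply: le_trans mY _; rewrite lee_fin; lra.
have Y0 : 0 < Y + 1 by rewrite ltr_wpDl // /Y mulr_ge0 ?sqrtr_ge0.
move: m0 ma Y1 Xa; move: (class_err _ _ _) (minimax_err _ _ _) => a m m0 ma mY1 Xa.
(* Numerator and denominator are compared with one finite positive number: Y + 1 if [a] is at least
   that, possibly infinite, and [a] itself otherwise. *)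
have [Ya|aY] := leP (Y + 1)%:E a.
  rewrite -(divff (lt0r_neq0 Y0)); apply: lee_ratio => //; first exact: ltW.
  by rewrite m0.
move: a aY ma Xa => [a| |] //= _.
rewrite lee_fin => ma Xa; have a0 : 0 < a by exact: lt_le_trans Xa.
rewrite -(divff (lt0r_neq0 a0)); apply: lee_ratio => //; first exact: ltW.
by rewrite m0.
Qed.

Lemma expR2_ge3 : 3 <= expR 2 :> R.
Proof. by apply: le_trans (expR_ge1Dx _); lra. Qed.

(** The interval around a centre c is (c / 2, 3 c / 2), and successive centres grow by exp 2 >=
    3. *)
Lemma expR_scales_disjoint K (x : R) (k l : 'I_K) :
  `|x - expR (2 * k%:R)| < expR (2 * k%:R) / 2 ->
  `|x - expR (2 * l%:R)| < expR (2 * l%:R) / 2 -> k = l.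
Proof.
have lt_false (a b : nat) : (a < b)%N ->
    `|x - expR (2 * a%:R)| < expR (2 * a%:R) / 2 ->
    `|x - expR (2 * b%:R)| < expR (2 * b%:R) / 2 -> False.
  move=> ab; rewrite !ltr_distl => /andP[_ h1] /andP[h2 _].
  have : expR (2 * a%:R) * expR 2 <= expR (2 * b%:R) :> R.
    rewrite -expRD ler_expR.
    have : (a.+1)%:R <= b%:R :> R by rewrite ler_nat.
    by rewrite -natr1; lra.
  have : expR (2 * a%:R) * 3 <= expR (2 * a%:R) * expR 2 :> R.
    by rewrite ler_pM2l ?expR_gt0 ?expR2_ge3.
  by lra.
move=> h1 h2; apply/val_inj; case: (ltngtP k l) => // kl; exfalso.
  exact: lt_false kl h1 h2.
exact: lt_false kl h2 h1.
Qed.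

Lemma poa_ge_lnln T delta rho (alg : algorithm R T) : (0 < T)%N -> 1 < rho ->
  0 < delta <= 2^-1 -> sfo_algs alg ->
  200 * ln delta^-1 < ln (ln rho) ->
  ((Num.sqrt (Num.min (ln delta^-1 + ln (ln rho)) T%:R / ln delta^-1) / 72)%:E
     <= poa delta alg (lip_classes 1 rho) (sfo_algs (T := T)))%E.
Proof.
move=> T0 rho1 /[dup] d2 /andP[_ d2'] sfo.
have D2 := ln_inv_ge d2; set D := ln delta^-1 in D2 *.
set L := ln (ln rho) => DL; have L100 : 100 < L by lra.
have Tp : 0 < T%:R :> R by rewrite ltr0n.
have N0 : 0 < ln rho by rewrite ln_gt0.
have NE : ln rho = expR L by rewrite lnK ?posrE.
(* Chosen so that (1 + s)^T <= exp (L / 2) = sqrt (log rho), which is below K / 8 as L > 100. *)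
pose s : R := Num.min 1 (L / (2 * T%:R)); pose eps := Num.sqrt s.
have s0 : 0 < s by rewrite lt_min ltr01 divr_gt0 //; lra.
have sL : T%:R * s <= L / 2.
  rewrite (_ : L / 2 = T%:R * (L / (2 * T%:R))); last by field; rewrite gt_eqF.
  by rewrite ler_pM2l // ge_min lexx orbT.
have e0 : 0 < eps by rewrite sqrtr_gt0.
have e1 : eps <= 1 by rewrite -[leRHS]sqrtr1 ler_sqrt // ge_min lexx.
have eE : eps ^+ 2 = s by rewrite sqr_sqrtr // ltW.
(* The largest K with exp (2 K) <= rho. *)
pose K := Num.truncn (ln rho / 2).
have /andP[K1 K2] : K%:R <= ln rho / 2 < K.+1%:R.
  by apply: truncn_itv; rewrite divr_ge0 // ltW.
pose m (k : 'I_K) : R := expR (2 * k%:R).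
have [] := @fano_class_err T delta alg K m (fun k => m k / 2) eps sfo d2'.
- by rewrite e0.
- rewrite eE; apply: (@le_trans _ _ (8 * expR (L / 2))).
    rewrite ler_pM2l //; apply: le_trans (exprn_1Dx_le _ (ltW s0)) _.
    by rewrite ler_expR.
  have h1 : 51 <= expR (L / 2) by apply: le_trans (expR_ge1Dx _); lra.
  move: K2; rewrite NE -[K.+1%:R]natr1 (_ : expR L = expR (L / 2) * expR (L / 2)); last first.
    by rewrite -expRD; congr expR; field.
  move: (expR (L / 2)) h1 => z z51 Kz.
  have : 51 * z <= z * z by rewrite ler_pM2r //; lra.
  by move: Kz; move: (K%:R) => y; lra.
- by move=> x k l; exact: expR_scales_disjoint.
(* The radius is fitted to the candidate: the error eps r / 2 is proportional to r = m k, and so is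
   the minimax bound. *)
move=> k /(_ (m k)); rewrite ger0_norm ?expR_ge0 // => /(_ (lexx _)) hX.
have m0 : 0 < m k by exact: expR_gt0.
have m1 : 1 <= m k by rewrite -expR0 ler_expR mulr_ge0.
have mrho : m k <= rho.
  rewrite -(@lnK _ rho) ?posrE ?(lt_trans _ rho1) // ler_expR.
  have : (k%:R : R) <= K%:R by rewrite ler_nat ltnW.
  by lra.
have sDT0 : 0 < Num.sqrt (D / T%:R) by rewrite sqrtr_gt0 divr_gt0 //; lra.
apply: (@le_trans _ _ (class_err delta alg (lip_class 1 (m k)) /
    minimax_err delta (sfo_algs (T := T)) (lip_class 1 (m k)))%E); last first.
  apply: ereal_sup_ubound; exists (lip_class 1 (m k)) => //.
  by exists 1, (m k); rewrite !lexx m1 mrho.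
have Y0 : 0 < 18 * m k * Num.sqrt (D / T%:R) by rewrite !mulr_gt0.
apply: le_trans (lee_ratio _ Y0 hX _); last 2 first.
- by apply: mulr_ge0; [exact: ltW|apply: divr_ge0 => //; exact: ltW].
- by rewrite minimax_err_class_ge0 ?(ltW m0) //= minimax_err_upper.
rewrite lee_fin.
rewrite (_ : _ / (18 * m k * _) = eps / Num.sqrt (D / T%:R) / 36); last first.
  by field; rewrite !gt_eqF.
have D0 : 0 < D by lra.
(* After squaring, min (D + L, T) <= 4 T s remains. Depending on the minimum in [s], 4 T s is 4 T or
   2 L, and D + L <= 2 L. *)
suff : Num.sqrt (Num.min (D + L) T%:R / D) <= 2 * (eps / Num.sqrt (D / T%:R)) by lra.
have B0 : 0 <= 2 * (eps / Num.sqrt (D / T%:R)).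
  by rewrite mulr_ge0 // divr_ge0 // ltW.
rewrite -(ger0_norm B0) -sqrtr_sqr; apply: ler_wsqrtr.
rewrite exprMn expr_div_n eE sqr_sqrtr; last by rewrite divr_ge0 // ltW.
rewrite (_ : 2 ^+ 2 * (s / (D / T%:R)) = 4 * (T%:R * s) / D); last first.
  by field; rewrite !gt_eqF.
rewrite ler_pM2r ?invr_gt0 // ge_min /s.
have [h|h] := leP 1 (L / (2 * T%:R)); apply/orP.
  by right; lra.
left; rewrite (_ : 4 * _ = 2 * L); first by lra.
by field; rewrite gt_eqF.
Qed.

Lemma poa_lower T delta rho (alg : algorithm R T) : (0 < T)%N -> 1 <= rho ->
  0 < delta <= 2^-1 -> sfo_algs alg ->
  ((72^-1 * poa_lower_bound T rho delta)%:E
     <= poa delta alg (lip_classes 1 rho) (sfo_algs (T := T)))%E.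
Proof.
move=> T0 rho1 /[dup] d2 /andP[d0 _] sfo; rewrite /poa_lower_bound.
have D2 := ln_inv_ge d2; have D0 : 0 < ln delta^-1 by lra.
case: (leP (ln rho) delta) => [_|lnrho].
  apply: (@le_trans _ _ 1%E); last exact: poa_ge1.
  by rewrite lee_fin mulr0 ler01.
have N0 : 0 < ln rho by exact: lt_trans lnrho.
rewrite lnM ?posrE ?invr_gt0 //.
(* With D = log (1 / delta) and L = log log rho, L <= 200 D gives (D + L) / D <= 201 < 72^2, so the
   claimed bound is at most 1. *)
have [DL|DL] := leP (ln (ln rho)) (200 * ln delta^-1); last first.
  rewrite mulrC; apply: poa_ge_lnln => //.
  by rewrite lt_neqAle rho1 andbT; apply: contraTneq N0 => <-; rewrite ln1 ltxx.
apply: (@le_trans _ _ 1%E); last exact: poa_ge1.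
rewrite lee_fin.
rewrite -ler_pdivlMl ?invr_gt0 // invrK mulr1.
rewrite -[leRHS]ger0_norm // -sqrtr_sqr; apply: ler_wsqrtr.
rewrite ler_pdivrMr // ge_min; apply/orP; left; rewrite expr2; nra.
Qed.

End poa.

Theorem theorem2 (R : realType) :
  exists2 c : R, 0 < c &
    forall (T : nat) (rho delta : R) (alg : algorithm R T),
      (1 <= T)%N -> 1 <= rho -> 0 < delta <= 2^-1 ->
      sfo_algs alg ->
      (poa delta alg (lip_classes 1 rho) (sfo_algs (T := T))
         <= poa delta alg (lip_classes 1 rho) (so_algs (T := T)))%E /\
      ((c * poa_lower_bound T rho delta)%:E
         <= poa delta alg (lip_classes 1 rho) (sfo_algs (T := T)))%E.
Proof.
exists 72^-1; first by rewrite invr_gt0.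
move=> T rho delta alg T1 rho1 d2 sfo; split; last exact: poa_lower.
apply: poa_le; [lra| |exact: sfo_sub_so].
(* [hard 0 0] has objective 0 and lies in every class, which [poa_le] requires to be inhabited. *)
move=> I [L [r [L1 /andP[r1 _] ->]]]; exists L, r, (hard 0 0); split => //.
have -> : L = 1 by apply/eqP; rewrite eq_le andbC.
by apply: hard_lip_class; rewrite ?lexx ?ler01 // normr0 (le_trans _ r1).
Qed.
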